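(* Let $m,d,k$ be positive integers satisfying $m \geq 1$, $d \geq 2$ and $1 \leq k \leq \lfloor (d+1)/2 \rfloor$. Then there exists an integral convex polytope $\mathcal{P}$ of dimension $d$ whose Ehrhart polynomial $i(\mathcal{P},n)$ coincides with $$\binom{d+n}{d} + m \binom{d+n-k}{d}$$ as a polynomial in $n$.
   Context: An integral convex polytope $\mathcal{P} \subset \mathbb{R}^N$ is a convex polytope all of whose vertices have integer coordinates. For a positive integer $n$, let $i(\mathcal{P},n) = |n\mathcal{P} \cap \mathbb{Z}^N|$, where $n\mathcal{P} = \{n\alpha : \alpha \in \mathcal{P}\}$. By Ehrhart's theorem, if $\mathcal{P}$ has dimension $d$ then $i(\mathcal{P},n)$ agrees with a polynomial in $n$ of degree $d$ (with constant term $1$); this polynomial is called the Ehrhart polynomial of $\mathcal{P}$. Here $\binom{d+n}{d}$ denotes the polynomial $\frac{(n+d)(n+d-1)\cdots(n+1)}{d!}$ in $n$, and similarly $\binom{d+n-k}{d} = \frac{(n+d-k)(n+d-k-1)\cdots(n-k+1)}{d!}$. *)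

(* Defs.v *)
From HB Require Import structures.
From mathcomp Require Import all_boot all_order all_algebra archimedean finmap.
From mathcomp Require Import boolp classical_sets cardinality reals.

Set Implicit Arguments.
Unset Strict Implicit.
Unset Printing Implicit Defensive.

Import Order.TTheory GRing.Theory Num.Theory.

Local Open Scope classical_set_scope.
Local Open Scope ring_scope.

Section Polytopes.
Variables (R : realType) (N : nat).
Implicit Types (P : set 'rV[R]_N) (x y v : 'rV[R]_N).

Definition conv_hull (V : seq 'rV[R]_N) : set 'rV[R]_N :=
  [set x | exists l : 'I_(size V) -> R,
     [/\ forall i, 0 <= l i, \sum_i l i = 1 & x = \sum_i l i *: V`_i]].

Definition convex_polytope P := exists V : seq 'rV[R]_N, P = conv_hull V.

(* For a convex polytope the vertices are exactly the extreme points. *)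
Definition vertex P v :=
  P v /\ forall x y (t : R), P x -> P y -> 0 < t -> t < 1 ->
    v = t *: x + (1 - t) *: y -> x = v /\ y = v.

Definition integer_point : set 'rV[R]_N :=
  [set x | forall j, x ord0 j \is a Num.int].

Definition integral_convex_polytope P :=
  convex_polytope P /\ forall v, vertex P v -> integer_point v.

Definition affine_hull P : set 'rV[R]_N :=
  [set x | exists (r : nat) (p : 'I_r -> 'rV[R]_N) (l : 'I_r -> R),
     [/\ forall i, P (p i), \sum_i l i = 1 & x = \sum_i l i *: p i]].

(* The affine hull is a translate of a d-dimensional linear subspace; in
   particular no dimension is assigned to the empty set. *)
Definition has_dimension P (d : nat) :=
  exists (x0 : 'rV[R]_N) (W : {vspace 'rV[R]_N}),
    \dim W = d /\ affine_hull P = [set x0 + w | w in [set w | w \in W]].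

Definition dilate (n : nat) P : set 'rV[R]_N := [set n%:R *: x | x in P].

Definition lattice_points P (n : nat) : set 'rV[R]_N :=
  dilate n P `&` integer_point.

(* i(P, n).  [fset_set] of an infinite set is empty, so this is meaningful only
   when [lattice_points P n] is finite. *)
Definition lattice_count P (n : nat) : nat := #|` fset_set (lattice_points P n)|.

(* Such a [p] is unique, as its values at all positive integers are fixed. *)
Definition is_ehrhart_polynomial P (p : {poly rat}) :=
  forall n : nat, (0 < n)%N ->
    finite_set (lattice_points P n) /\ (lattice_count P n)%:R = p.[n%:R].

End Polytopes.

(* The polynomial (n + d - k)(n + d - k - 1) ... (n - k + 1) / d! in n = 'X. *)
Definition binom_poly (d k : nat) : {poly rat} :=
  (d`!)%:R^-1 *: \prod_(i < d) ('X + (d%:R - k%:R - (i : nat)%:R)%:P).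

(* Main.v *)
(* Let P be the convex hull in R^(d+1) of the standard basis vectors
   e_1, ..., e_d and of the apex (m + 1, -1, ..., -1, 1, ..., 1, 0, ..., 0)
   with k - 1 entries -1 and k entries 1; it is a d-simplex since the last d
   coordinates of each vertex add up to 1.  A lattice point of nP is a
   nonnegative combination, with coefficients adding up to n, of the vertices.
   The class r mod m + 1 of its first coordinate determines the fractional
   parts of these coefficients: they vanish for r = 0, and otherwise k of them
   are r / (m + 1) and k are 1 - r / (m + 1), adding up to k.  The integral
   parts are then d + 1 arbitrary naturals of sum n, respectively n - k, which
   yields C(n + d, d) points for r = 0 and C(n + d - k, d) points for each of
   the m other classes. *)
Require Import Defs.
From mathcomp Require Import all_boot all_order all_algebra archimedean finmap.
From mathcomp Require Import boolp classical_sets cardinality reals.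
From mathcomp Require Import zify ring lra.

Set Implicit Arguments.
Unset Strict Implicit.
Unset Printing Implicit Defensive.

Import Order.TTheory GRing.Theory Num.Theory.

Local Open Scope ring_scope.

(** * Binomial polynomials and tuples with prescribed sum *)

Lemma prod_natrB_ffact (A : pzRingType) (n d : nat) :
  \prod_(i < d) (n%:R - (i : nat)%:R) = (n ^_ d)%:R :> A.
Proof.
elim: d => [|d IHd]; first by rewrite big_ord0.
rewrite big_ord_recr /= IHd ffactnSr natrM.
have [le_dn|lt_nd] := leqP d n; first by rewrite natrB.
by rewrite ffact_small // !mul0r.
Qed.

(** As [k <= d], the subtraction [n + d - k] is not truncated, and the product is a falling
    factorial; for [n < k] both sides vanish. *)
Lemma horner_binom_poly (d k n : nat) : (k <= d)%N ->
  (binom_poly d k).[n%:R] = 'C(n + d - k, d)%:R.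
Proof.
move=> le_kd; rewrite /binom_poly hornerZ horner_prod.
have dfact_neq0 : (d`!)%:R != 0 :> rat by rewrite pnatr_eq0 -lt0n fact_gt0.
apply: (mulfI dfact_neq0); rewrite mulVKf // -natrM mulnC bin_ffact.
rewrite -prod_natrB_ffact; apply: eq_bigr => i _.
rewrite !hornerE natrB ?natrD ?addrA //; lia.
Qed.

(** Entries adding up to [n - s] are at most [n - s], so shrinking the range of the entries loses no
    tuple. The hypothesis excludes [d = 0], [n < s], where truncation would give ['C(0, 0) = 1]. *)
Lemma card_ord_tuples_sum (d n s : nat) : (s <= n + d)%N ->
  #|[set t : d.+1.-tuple 'I_n.+1 | \sum_(i <- t) i + s == n]%N|
    = 'C(n + d - s, d).
Proof.
move=> le_s; have [le_sn|lt_ns] := leqP s n; last first.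
  rewrite bin_small; last lia.
  by apply/eqP; rewrite cards_eq0; apply/eqP/setP => t; rewrite !inE; lia.
have -> : (n + d - s = d + (n - s))%N by lia.
rewrite -card_ord_partitions.
pose wide := widen_ord (leq_subr s n : (n - s).+1 <= n.+1)%N.
have wideI : injective (map_tuple wide : d.+1.-tuple _ -> _).
  have widenI : injective wide by move=> i j [] /val_inj.
  by move=> t u /(congr1 val) /(inj_map widenI) /val_inj.
rewrite -[RHS](card_imset _ wideI).
apply: eq_card => t; rewrite inE; apply/eqP/imsetP => [sum_t|[u]].
  have le_t i : (tnth t i <= n - s)%N.
    move: sum_t; rewrite big_tuple (bigD1 i) //=; lia.
  have t_eq : t = map_tuple wide (map_tuple (fun i : 'I_n.+1 => inord i) t).
    apply: eq_from_tnth => i; rewrite !tnth_map; apply: val_inj.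
    by rewrite /= inordK // ltnS.
  exists (map_tuple (fun i : 'I_n.+1 => inord i) t) => //.
  rewrite inE; apply/eqP/(@addIn s); rewrite subnK // -[RHS]sum_t; congr addn.
  by rewrite big_map !big_tuple; apply: eq_bigr => i _; rewrite inordK // ltnS.
rewrite inE => /eqP sum_u ->; rewrite big_map.
by rewrite -[RHS](subnK le_sn); congr addn.
Qed.

Lemma sum_ord_ltn (d c : nat) : (c <= d)%N -> \sum_(i < d) (i < c)%N%:Z = c%:Z.
Proof.
elim: d => [|d IHd]; first by rewrite leqn0 => /eqP ->; rewrite big_ord0.
rewrite big_ord_recr /= leq_eqVlt ltnS => /predU1P[->|le_cd].
  rewrite ltnSn (eq_bigr (fun=> 1)) ?sumr_const ?card_ord; first lia.
  by move=> i _; rewrite ltnS ltnW.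
by rewrite IHd // ltnNge le_cd addr0.
Qed.

Local Open Scope classical_set_scope.

Lemma fset_set_image_finset (T : finType) (U : choiceType) (g : T -> U)
    (A : {set T}) : injective g ->
  finite_set [set g t | t in [set` A]] /\
  #|` fset_set [set g t | t in [set` A]]| = #|A|.
Proof.
move=> g_inj; have finA : finite_set [set` A] by exact: finite_finset.
split; first exact: finite_image.
rewrite fset_set_image // card_imfset //= cardE.
apply: perm_size; apply: uniq_perm; rewrite ?enum_uniq ?fset_uniq // => x.
by rewrite mem_enum in_fset_set // mem_setE.
Qed.

(** * Convex hulls of finite sequences and their vertices *)

Section ConvexHull.
Variables (R : realType) (N : nat).

Lemma conv_hullP (V : seq 'rV[R]_N) (n : nat) (v : 'I_n -> 'rV[R]_N) x :
  V = [seq v i | i <- enum 'I_n] ->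
  conv_hull V x <-> exists l : 'I_n -> R,
    [/\ forall i, 0 <= l i, \sum_i l i = 1 & x = \sum_i l i *: v i].
Proof.
move=> defV; have sizeV : size V = n by rewrite defV size_map size_enum_ord.
have nthV (i : 'I_(size V)) : V`_i = v (cast_ord sizeV i).
  have ltVn : (i < n)%N by rewrite -sizeV.
  have -> : cast_ord sizeV i = Ordinal ltVn by exact: val_inj.
  move: (i : nat) ltVn => j lt_jn.
  rewrite defV (nth_map (Ordinal lt_jn)) ?size_enum_ord //.
  by congr v; apply: val_inj; rewrite /= nth_enum_ord.
have castK := cast_ordK sizeV; have castKV := cast_ordKV sizeV.
have cast_on : {on [pred i | true], bijective (cast_ord sizeV)}.
  by apply: onW_bij; exists (cast_ord (esym sizeV)).
split=> -[l [l_ge0 l_sum ->]].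
  exists (l \o cast_ord (esym sizeV)); split=> [i||].
  - exact: l_ge0.
  - rewrite -[RHS]l_sum (reindex _ cast_on) //=.
    by apply: eq_bigr => i _; rewrite castK.
  - rewrite [RHS](reindex _ cast_on) //=.
    by apply: eq_bigr => i _; rewrite castK nthV.
exists (l \o cast_ord sizeV); split=> [i||].
- exact: l_ge0.
- by rewrite -l_sum [RHS](reindex _ cast_on).
- rewrite (reindex _ cast_on) //=.
  by apply: eq_bigr => i _; rewrite nthV.
Qed.

Lemma mem_conv_hull (V : seq 'rV[R]_N) v : v \in V -> conv_hull V v.
Proof.
move=> /(nthP 0)[j lt_jV <-]; pose i := Ordinal lt_jV.
exists (fun j => (j == i)%:R); split=> [?||].
- exact: ler0n.
- by rewrite (bigD1 i) //= eqxx big1 ?addr0 // => ? /negPf ->.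
- rewrite (bigD1 i) //= eqxx scale1r big1 ?addr0 // => ? /negPf ->.
  by rewrite scale0r.
Qed.

(** Some generator has positive weight in [v]. Either its weight is 1, or [v] lies strictly between
    it and another point of the hull, and extremality applies. *)
Lemma vertex_conv_hull (V : seq 'rV[R]_N) v :
  vertex (conv_hull V) v -> exists i : 'I_(size V), v = V`_i.
Proof.
move=> [[l [l_ge0 l_sum v_eq]] v_ext].
have [i l_gt0|l_le0] := pickP (fun i => 0 < l i); last first.
  suff : \sum_i l i = 0 by move/eqP; rewrite l_sum oner_eq0.
  by apply: big1 => i _; apply/eqP; rewrite eq_le l_ge0 leNgt l_le0.
exists i; rewrite (bigD1 i) //= in l_sum; rewrite (bigD1 i) //= in v_eq.
have l_le1 : l i <= 1 by rewrite -l_sum lerDl sumr_ge0.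
have [l_eq1|l_lt1] := eqVneq (l i) 1.
  have /eqP : \sum_(j | j != i) l j = 0 by move: l_sum; rewrite l_eq1; lra.
  rewrite psumr_eq0 => [/allP l0|j _]; last exact: l_ge0.
  rewrite v_eq l_eq1 scale1r big1 ?addr0 // => j ji.
  by have /implyP/(_ ji)/eqP -> := l0 j (mem_index_enum j); rewrite scale0r.
have l_lt : l i < 1 by rewrite lt_neqAle l_lt1.
have l'_neq0 : 1 - l i != 0 by rewrite subr_eq0 eq_sym.
(* The remaining generators, with weights renormalised to sum 1. *)
pose y := \sum_(j | j != i) (l j / (1 - l i)) *: V`_j.
have Py : conv_hull V y.
  exists (fun j => if j == i then 0 else l j / (1 - l i)); split=> [j||].
  - by case: ifP => // _; rewrite divr_ge0 ?subr_ge0.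
  - rewrite (bigD1 i) //= eqxx add0r (eq_bigr (fun j => l j / (1 - l i))).
      rewrite -mulr_suml; have -> : \sum_(j | j != i) l j = 1 - l i.
        by rewrite -l_sum addrAC subrr add0r.
      by rewrite divff.
    by move=> j /negPf ->.
  - rewrite [RHS](bigD1 i) //= eqxx scale0r add0r.
    by apply: eq_bigr => j /negPf ->.
have [] // := v_ext _ y _ (mem_conv_hull (mem_nth 0 (ltn_ord i))) Py l_gt0 l_lt.
rewrite v_eq; congr (_ + _); rewrite scaler_sumr; apply: eq_bigr => j _.
by rewrite scalerA mulrCA divff // mulr1.
Qed.

Lemma integral_conv_hull (V : seq 'rV[R]_N) :
  (forall i : 'I_(size V), integer_point V`_i) ->
  integral_convex_polytope (conv_hull V).
Proof.
move=> V_int; split; first by exists V.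
by move=> v /vertex_conv_hull[i ->].
Qed.

End ConvexHull.

(** * The simplex: apex weights, vertices and facet inequalities *)

Section Simplex.
Variables (R : realType) (m d k : nat).
Hypotheses (k_gt0 : (0 < k)%N) (k_le : (k.*2.-1 <= d)%N).

(* Coordinate [i + 1] of the apex: -1 for the first k - 1 indices, 1 for the
   next k ones, and 0 beyond. *)
Definition apex_weight (i : nat) : int :=
  (i < k.*2.-1)%N%:Z - (i < k.-1)%N%:Z *+ 2.

Definition apex_pos (i : nat) : bool := (k.-1 <= i < k.*2.-1)%N.

Variant apex_weight_spec (i : nat) : int -> bool -> Type :=
  | ApexWeight0 : apex_weight_spec i 0 false
  | ApexWeight1 : apex_weight_spec i 1 true
  | ApexWeightN1 : apex_weight_spec i (-1) false.

Lemma apex_weightP i : apex_weight_spec i (apex_weight i) (apex_pos i).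
Proof.
rewrite /apex_weight /apex_pos.
have [lt1|ge1] := ltnP i k.-1.
  have -> : (i < k.*2.-1)%N by lia.
  exact: ApexWeightN1.
by case: ltnP => _ /=; constructor.
Qed.

Lemma sum_apex_weight : \sum_(i < d) apex_weight i = 1.
Proof. by rewrite sumrB sumrMnl !sum_ord_ltn; lia. Qed.

Lemma sum_apex_pos : \sum_(i < d) (apex_pos i)%:Z = k%:Z.
Proof.
have -> : k%:Z = k.*2.-1%:Z - k.-1%:Z by lia.
rewrite -(sum_ord_ltn k_le) -(@sum_ord_ltn d k.-1); last lia.
rewrite -sumrB; apply: eq_bigr => i _; rewrite /apex_pos.
have [lt1|ge1] := ltnP i k.-1; last by rewrite subr0.
by have -> : (i < k.*2.-1)%N by lia.
Qed.

(** Divide by [m + 1] and round [w r / (m + 1)] up, where [w] is the weight: since [r <= m], this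
    gives 0 for [w = 0] or [w = -1], and 1 exactly when [w = 1] and [r != 0]. *)
Lemma apex_weight_le (i q r : nat) (X : int) : (r < m.+1)%N ->
  (apex_weight i * (q * m.+1 + r)%N%:Z <= X * m.+1%:Z) =
  (0 <= X - apex_weight i * q%:Z - (apex_pos i && (r != 0%N))%:Z).
Proof.
case: apex_weightP => lt_r /=.
- rewrite !mul0r !subr0; apply/idP/idP; nia.
- rewrite !mul1r.
  (* This shift cancels [q], leaving [nia] an inequality in [Y], [r] and [m] only. *)
  have [Y ->] : exists Y, X = Y + q%:Z by exists (X - q%:Z); ring.
  rewrite PoszD PoszM mulrDl addrC lerD2r addrK.
  have [->|r_neq0] := eqVneq r 0%N; first by apply/idP/idP; nia.
  by apply/idP/idP; nia.
- have [Y ->] : exists Y, X = Y - q%:Z by exists (X + q%:Z); ring.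
  rewrite PoszD PoszM mulrBl mulN1r opprD addrC lerD2r mulN1r opprK subrK subr0.
  by apply/idP/idP; nia.
Qed.

(** The apex has index 0 and is the only vertex with nonzero coordinate 0, which makes the system
    for the coefficients triangular. *)
Definition simplex_vertex (i : 'I_d.+1) : 'rV[R]_d.+1 :=
  if unlift ord0 i is Some _ then delta_mx 0 i
  else \row_j (if unlift ord0 j is Some j' then (apex_weight j')%:~R
               else m.+1%:R).

Definition simplex : set 'rV[R]_d.+1 :=
  conv_hull [seq simplex_vertex i | i <- enum 'I_d.+1].

Lemma simplex_comb0 (l : 'I_d.+1 -> R) :
  (\sum_i l i *: simplex_vertex i) 0 0 = l 0 * m.+1%:R.
Proof.
rewrite summxE big_ord_recl big1 ?addr0 => [|i _].
  by rewrite /simplex_vertex unlift_none !mxE unlift_none.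
by rewrite /simplex_vertex liftK !mxE /= mulr0.
Qed.

Lemma simplex_combS (l : 'I_d.+1 -> R) (i : 'I_d) :
  (\sum_i l i *: simplex_vertex i) 0 (lift 0 i) =
  l (lift 0 i) + l 0 * (apex_weight i)%:~R.
Proof.
rewrite summxE big_ord_recl addrC; congr (_ + _).
  rewrite (bigD1 i) //= big1 ?addr0 => [|j /negPf ji].
    by rewrite /simplex_vertex liftK !mxE !eqxx mulr1.
  by rewrite /simplex_vertex liftK !mxE /= (inj_eq lift_inj) eq_sym ji mulr0.
by rewrite /simplex_vertex unlift_none !mxE liftK.
Qed.

(** Solution of that triangular system; it exists for every [x], as the vertices form a basis of the
    space. *)
Definition barycentric (x : 'rV[R]_d.+1) (j : 'I_d.+1) : R :=
  if unlift ord0 j is Some i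
  then x 0 j - x 0 0 / m.+1%:R * (apex_weight i)%:~R
  else x 0 0 / m.+1%:R.

Lemma barycentric_comb x : \sum_i barycentric x i *: simplex_vertex i = x.
Proof.
apply/rowP => j; case: (unliftP ord0 j) => [i|] ->.
  by rewrite simplex_combS /barycentric liftK unlift_none subrK.
by rewrite simplex_comb0 /barycentric unlift_none divfK ?pnatr_eq0.
Qed.

(** The linear form equal to 1 at every vertex; at the apex this is [sum_apex_weight]. *)
Definition height (x : 'rV[R]_d.+1) : R := \sum_(i < d) x 0 (lift 0 i).

Lemma height_comb (l : 'I_d.+1 -> R) :
  height (\sum_i l i *: simplex_vertex i) = \sum_i l i.
Proof.
rewrite /height (eq_bigr _ (fun i _ => simplex_combS l i)) big_split /=.
rewrite -mulr_sumr -(rmorph_sum (intmul 1)) sum_apex_weight mulr1.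
by rewrite [RHS]big_ord_recl addrC.
Qed.

Lemma sum_barycentric x : \sum_i barycentric x i = height x.
Proof. by rewrite -height_comb barycentric_comb. Qed.

Lemma heightZ (a : R) x : height (a *: x) = a * height x.
Proof. by rewrite /height mulr_sumr; apply: eq_bigr => i _; rewrite mxE. Qed.

(** Nonnegativity of the barycentric coordinates, with the denominator [m + 1] cleared so that
    lattice points give integer inequalities. *)
Lemma simplexP x : simplex x <->
  [/\ 0 <= x 0 0,
      forall i : 'I_d, (apex_weight i)%:~R * x 0 0 <= x 0 (lift 0 i) * m.+1%:R
    & height x = 1].
Proof.
have M_gt0 : 0 < m.+1%:R :> R by rewrite ltr0n.
rewrite /simplex (conv_hullP _ (erefl _)).
split=> [[l [l_ge0 l_sum ->]]|[x0_ge0 x_ge h_x]].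
  split=> [|i|]; rewrite ?height_comb // simplex_comb0.
    by rewrite mulr_ge0.
  rewrite simplex_combS mulrDl mulrA (mulrC _ (l 0)) lerDr.
  by rewrite mulr_ge0.
exists (barycentric x); split; rewrite ?sum_barycentric ?barycentric_comb //.
move=> j; rewrite /barycentric; case: (unliftP ord0 j) => [i ->|_].
  by rewrite subr_ge0 mulrAC ler_pdivrMr // mulrC x_ge.
by rewrite divr_ge0.
Qed.

Lemma dilate_simplexP (n : nat) x : (0 < n)%N -> dilate n simplex x <->
  [/\ 0 <= x 0 0,
      forall i : 'I_d, (apex_weight i)%:~R * x 0 0 <= x 0 (lift 0 i) * m.+1%:R
    & height x = n%:R].
Proof.
move=> n_gt0; have n_gt0R : 0 < n%:R :> R by rewrite ltr0n.
have n_neq0 : n%:R != 0 :> R by rewrite gt_eqF.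
split=> [[y /simplexP[y0_ge0 y_ge h_y] <-]|[x0_ge0 x_ge h_x]].
  split=> [|i|]; rewrite ?heightZ ?h_y ?mulr1 // !mxE.
    by rewrite mulr_ge0 // ltW.
  by rewrite mulrCA -mulrA ler_pM2l.
exists (n%:R^-1 *: x); last by rewrite scalerA divff // scale1r.
apply/simplexP; split=> [|i|]; rewrite ?heightZ ?h_x ?mulVf // !mxE.
  by rewrite mulr_ge0 // invr_ge0 ltW.
by rewrite mulrCA -mulrA ler_pM2l // invr_gt0.
Qed.

Lemma integral_simplex : integral_convex_polytope simplex.
Proof.
apply: integral_conv_hull => i.
have /mapP[j _ ->] := mem_nth 0 (ltn_ord i).
rewrite /integer_point /= /simplex_vertex => c.
case: unlift => [_|]; rewrite !mxE ?natr_int //.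
by case: unlift => [?|]; rewrite ?intr_int ?natr_int.
Qed.

Lemma simplex_vertex_in i : simplex (simplex_vertex i).
Proof. by apply/mem_conv_hull/map_f; rewrite mem_enum. Qed.

(** * Affine hull and dimension *)

Lemma affine_hull_simplex : affine_hull simplex = [set x | height x = 1].
Proof.
apply/seteqP; split=> x /=.
  move=> [r [p [l [p_in l_sum ->]]]].
  rewrite -l_sum /height; under eq_bigr do rewrite summxE.
  rewrite exchange_big; apply: eq_bigr => i _ /=.
  have /simplexP[_ _ h_p] := p_in i.
  by rewrite -[RHS]mulr1 -h_p mulr_sumr; apply: eq_bigr => j _; rewrite mxE.
move=> h_x; exists d.+1, simplex_vertex, (barycentric x).
split; rewrite ?sum_barycentric ?barycentric_comb //.
exact: simplex_vertex_in.
Qed.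

Lemma has_dimension_simplex : has_dimension simplex d.
Proof.
(* Multiplication by [c] realises [height] as a linear map, whose kernel is the direction of the
   affine hull. *)
pose c : 'cV[R]_d.+1 := \col_j (j != 0)%:R.
have heightE x : (x *m c) 0 0 = height x.
  rewrite mxE big_ord_recl !mxE eqxx mulr0 add0r.
  by apply: eq_bigr => i _; rewrite mxE /= mulr1.
pose f := linfun (mulmxr c : 'rV[R]_d.+1 -> 'rV[R]_1).
have f_ker x : (x \in lker f) = (height x == 0).
  rewrite memv_ker lfunE /= -heightE; apply/eqP/eqP => [->|h0].
    by rewrite mxE.
  by apply/rowP => j; rewrite !ord1 h0 mxE.
have /simplexP[_ _ h_apex] := simplex_vertex_in 0.
exists (simplex_vertex 0), (lker f); split.
  (* Rank-nullity: the image is a line, because the apex has height 1. *)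
  have := limg_ker_dim f fullv; rewrite capfv dimvf dim_matrix mul1r.
  suff -> : \dim (limg f) = 1%N by rewrite addn1 => -[].
  apply/eqP; rewrite eqn_leq; apply/andP; split.
    by rewrite (leq_trans (dimvS (subvf _))) // dimvf dim_matrix.
  have := memv_img f (memvf (simplex_vertex 0)).
  rewrite lt0n dimv_eq0; apply: contraTneq => ->.
  by rewrite memv0 -memv_ker f_ker h_apex oner_eq0.
have heightD x y : height (x + y) = height x + height y.
  by rewrite -!heightE mulmxDl mxE.
rewrite affine_hull_simplex; apply/seteqP; split=> x /=.
  move=> h_x; exists (x - simplex_vertex 0); last by rewrite addrC subrK.
  by rewrite /= f_ker heightD h_x -scaleN1r heightZ h_apex mulr1 subrr.
move=> [w]; rewrite /= f_ker => /eqP h_w <-.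
by rewrite heightD h_apex h_w addr0.
Qed.

(** * Parametrisation and count of the lattice points *)

(* If [a = q (m + 1) + r] is the coordinate of index 0, the barycentric
   coordinates of a lattice point are [a / (m + 1)] and
   [x_i - w_i a / (m + 1)]; the tuple records their integral parts, where
   rounding [w_i r / (m + 1)] up costs one unit exactly when [w_i = 1] and
   [r != 0]. *)
Definition lattice_point_of n (u : 'I_m.+1 * d.+1.-tuple 'I_n.+1) :
    'rV[R]_d.+1 :=
  \row_j (if unlift ord0 j is Some i then
             (tnth u.2 j)%:Z + apex_weight i * (tnth u.2 ord0)%:Z
               + (apex_pos i && (u.1 != 0%N :> nat))%:Z
           else (tnth u.2 ord0 * m.+1 + u.1)%N%:Z)%:~R.

(** A nonzero residue costs one unit at each of the [k] weights 1, so the integral parts then add up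
    to [n - k]. *)
Definition admissible n : {set 'I_m.+1 * d.+1.-tuple 'I_n.+1} :=
  finset (fun u : 'I_m.+1 * d.+1.-tuple 'I_n.+1 =>
    (\sum_(i <- u.2) i + (u.1 != 0%N :> nat) * k == n)%N).

(** Quotient and remainder of coordinate 0 by [m + 1] recover [tnth u.2 ord0] and [u.1]; the other
    coordinates then give the other entries. *)
Lemma lattice_point_of_inj n : injective (@lattice_point_of n).
Proof.
move=> [r t] [s u] /rowP eq_rt.
have := eq_rt ord0; rewrite !mxE unlift_none /= => /intr_inj [eq0].
have eqr : r = s.
  apply: val_inj; have := congr1 (modn^~ m.+1) eq0.
  by rewrite !modnMDl !modn_small.
have eqt0 : tnth t ord0 = tnth u ord0 :> nat.
  have := congr1 (divn^~ m.+1) eq0.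
  by rewrite !divnMDl // !divn_small // !addn0.
congr pair => //; apply: eq_from_tnth => j; apply: val_inj.
case: (unliftP ord0 j) => [i ->|->] //.
have := eq_rt (lift ord0 i); rewrite !mxE liftK /= eqr eqt0.
by move=> /intr_inj /addIr /addIr [].
Qed.

Lemma lattice_points_simplex n : (0 < n)%N ->
  lattice_points simplex n =
  [set lattice_point_of u | u in [set` admissible n]].
Proof.
move=> n_gt0; apply/seteqP; split=> x /=; last first.
  move=> [[r t]]; rewrite /= inE big_tuple big_ord_recl /= => /eqP sum_t <-.
  split; last by move=> j; rewrite mxE intr_int.
  apply/(dilate_simplexP _ n_gt0); split=> [|i|].
  - by rewrite mxE unlift_none ler0n.
  - rewrite !mxE unlift_none liftK (pmulrn 1 m.+1) -!intrM ler_int.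
    by rewrite apex_weight_le //= addrAC !addrK.
  (* The conjunction becomes a product, so that the sum of [apex_pos] factors out as [k]. *)
  - rewrite /height (eq_bigr (fun i : 'I_d => (
       (tnth t (lift ord0 i))%:Z + apex_weight i * (tnth t ord0)%:Z
       + (r != 0%N :> nat)%:Z * (apex_pos i)%:Z)%:~R)); last first.
      by move=> i _; rewrite mxE liftK /=; case: apex_pos; case: eqP.
    rewrite -(rmorph_sum (intmul 1)) !big_split /= -mulr_suml -mulr_sumr.
    rewrite sum_apex_weight sum_apex_pos mul1r [RHS]pmulrn.
    congr _%:~R; rewrite -(big_morph Posz PoszD (erefl _)).
    by move: sum_t; case: (_ != _) => /=; lia.
move=> [/(dilate_simplexP _ n_gt0)[x0_ge0 x_ge h_x] x_int].
pose X j := Num.floor (x ord0 j).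
have xE j : x ord0 j = (X j)%:~R by rewrite floorK //; apply: x_int.
have X0_ge0 : 0 <= X ord0 by rewrite -(@ler_int R) -xE.
set q := (`|X ord0| %/ m.+1)%N; set r := (`|X ord0| %% m.+1)%N.
have lt_r : (r < m.+1)%N by rewrite ltn_mod.
have X0E : X ord0 = (q * m.+1 + r)%N by rewrite -divn_eq gez0_abs.
have X_ge (i : 'I_d) :
    0 <= X (lift ord0 i) - apex_weight i * q%:Z - (apex_pos i && (r != 0%N))%:Z.
  by rewrite -apex_weight_le // -X0E -(@ler_int R) !intrM -!xE x_ge.
(* The slacks of the rounded facet inequalities; by [X_ge] the absolute value changes nothing. *)
pose t j := if unlift ord0 j is Some i then
  absz (X j - apex_weight i * q%:Z - (apex_pos i && (r != 0%N))%:Z)%R else q.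
have tS (i : 'I_d) : (t (lift ord0 i))%:Z =
    X (lift ord0 i) - apex_weight i * q%:Z - (r != 0%N)%:Z * (apex_pos i)%:Z.
  rewrite /t liftK gez0_abs // andbC; congr (_ - _).
  by case: apex_pos; case: eqP.
have t0 : t ord0 = q by rewrite /t unlift_none.
have sumX : \sum_(i < d) X (lift ord0 i) = n%:Z.
  apply: (@intr_inj R); rewrite (rmorph_sum (intmul 1)) -[RHS]h_x.
  by apply: eq_bigr => i _; rewrite xE.
have sum_t : (\sum_j t j + (r != 0%N) * k = n)%N.
  apply/eqP; rewrite -eqz_nat big_ord_recl t0 !PoszD PoszM.
  rewrite (big_morph Posz PoszD (erefl _)); under eq_bigr do rewrite tS.
  rewrite !sumrB -mulr_suml -mulr_sumr sumX sum_apex_weight sum_apex_pos.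
  by apply/eqP; ring.
(* Naturals with sum at most [n] fit in ['I_n.+1], so the finite range misses no lattice point. *)
have t_le j : (t j < n.+1)%N.
  by rewrite ltnS -sum_t (bigD1 j) //= -addnA leq_addr.
have [u uE] : exists u : d.+1.-tuple 'I_n.+1, forall j, tnth u j = t j :> nat.
  by exists (mktuple (fun j => Ordinal (t_le j))) => j; rewrite tnth_mktuple.
exists (Ordinal lt_r, u).
  by rewrite /= inE /= big_tuple (eq_bigr _ (fun j _ => uE j)) sum_t.
apply/rowP => j; rewrite mxE xE; congr _%:~R.
case: (unliftP ord0 j) => [i ->|->];
  rewrite ?liftK ?unlift_none /= !uE t0.
  by rewrite tS; case: apex_pos; case: eqP => _ /=; ring.
by rewrite X0E.
Qed.

Lemma card_admissible n : (k <= d)%N ->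
  #|admissible n| = ('C(n + d, d) + m * 'C(n + d - k, d))%N.
Proof.
move=> le_kd; pose Q (r : 'I_m.+1) (t : d.+1.-tuple 'I_n.+1) :=
  (\sum_(i <- t) i + (r != 0%N :> nat) * k == n)%N.
(* As a sum of ones, the cardinality splits by residue. *)
rewrite -sum1_card (eq_bigl (fun u => true && Q u.1 u.2)); last first.
  by move=> u; rewrite inE.
rewrite -(pair_big_dep xpredT Q (fun _ _ => 1%N)) /=.
have le_k : (k <= n + d)%N := leq_trans le_kd (leq_addl _ _).
rewrite big_ord_recl /Q /= mul0n sum1dep_card card_ord_tuples_sum // subn0.
under eq_bigr do rewrite mul1n sum1dep_card card_ord_tuples_sum //.
by rewrite sum_nat_const card_ord.
Qed.

Lemma ehrhart_simplex : (k <= d)%N ->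
  is_ehrhart_polynomial simplex (binom_poly d 0 + m%:R *: binom_poly d k).
Proof.
move=> le_kd n n_gt0; rewrite /lattice_count lattice_points_simplex //.
have [fin ->] := fset_set_image_finset (admissible n) (@lattice_point_of_inj n).
split=> //; rewrite card_admissible //.
by rewrite hornerD (hornerZ m%:R) !horner_binom_poly // subn0 natrD natrM.
Qed.

End Simplex.

Theorem theorem1p1 (R : realType) (m d k : nat)
    (hm : (1 <= m)%N) (hd : (2 <= d)%N)
    (hk1 : (1 <= k)%N) (hk2 : (k <= (d + 1) %/ 2)%N) :
  exists (N : nat) (P : set 'rV[R]_N),
    [/\ integral_convex_polytope P,
        has_dimension P d
      & is_ehrhart_polynomial P (binom_poly d 0 + m%:R *: binom_poly d k)].
Proof.
(* The bound on [k] says exactly that the [2k - 1] nonzero weights fit in [d] coordinates. *)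
have le_2k : (k.*2.-1 <= d)%N by lia.
exists d.+1, (@simplex R m d k); split.
- exact: integral_simplex.
- exact: has_dimension_simplex.
- by apply: ehrhart_simplex => //; lia.
Qed.
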